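(* Let $H_5$ be the five-dimensional Heisenberg Lie group with its canonical left-invariant metric and Lie algebra $\mathfrak n=\mathfrak h_5=\mathfrak v\oplus\mathfrak z$. Let $F:\mathfrak n\to\mathfrak n$ be a left-invariant Lorentz force of type I such that $Fj(Z)=j(Z)F$ on $\mathfrak v$ for $Z\in\mathfrak z$. If $F$ does not correspond to an exact form, then for every $E\ge0$ there is a periodic magnetic trajectory for $F$ with energy $E$.
   Context: $\mathfrak h_5$ is the Lie algebra with basis $X_1,Y_1,X_2,Y_2,Z$ and non-trivial brackets $[X_1,Y_1]=[X_2,Y_2]=Z$; $H_5$ is the simply connected Lie group with Lie algebra $\mathfrak h_5$. The canonical metric is the left-invariant metric making this basis orthonormal. $\mathfrak z=\mathrm{span}\{Z\}$ is the center and $\mathfrak v=\mathfrak z^\perp=\mathrm{span}\{X_1,Y_1,X_2,Y_2\}$. The linear map $j:\mathfrak z\to\mathfrak{so}(\mathfrak v)$ is defined by $\langle \widetilde Z,[V,W]\rangle=\langle j(\widetilde Z)V,W\rangle$. A left-invariant Lorentz force is a left-invariant skew-symmetric $(1,1)$-tensor $F$ (equivalently a skew-symmetric map $F:\mathfrak n\to\mathfrak n$) such that the left-invariant 2-form $\omega_F(U,V)=\langle FU,V\rangle$ is closed. $F$ is of type I if $F(\mathfrak v)\subseteq\mathfrak v$ and $F(\mathfrak z)\subseteq\mathfrak z$. $F$ corresponds to an exact form if $F=j(\widetilde Z)$ (extended by $0$ on $\mathfrak z$) for some $\widetilde Z\in C(\mathfrak n)=[\mathfrak n,\mathfrak n]$.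 A magnetic trajectory for $F$ is a curve $\sigma$ with $\nabla_{\sigma'}\sigma'=F\sigma'$, $\nabla$ the Levi-Civita connection. The energy of $X\in\mathfrak n$ is $E(X)=\frac12\langle X,X\rangle$, and the energy of a curve $\sigma$ is the energy of $\sigma'(0)$. A curve $\sigma$ is periodic if $\sigma(t+\omega)=\sigma(t)$ for all $t\in\mathbb R$ for some $\omega\neq0$. *)

(* Defs.v *)
From HB Require Import structures.
From mathcomp Require Import all_boot all_order all_algebra.
From mathcomp Require Import all_classical all_reals all_analysis.
From mathcomp Require Import ring.

Set Implicit Arguments.
Unset Strict Implicit.
Unset Printing Implicit Defensive.

Import Order.TTheory GRing.Theory Num.Theory.
Import numFieldNormedType.Exports.

Local Open Scope ring_scope.

(* Riemannian geometry of R^n in its global chart: a metric is given by the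
   bilinear forms g p on the tangent spaces, all identified with R^n.         *)
Section Chart.
Variables (R : realType) (n : nat).
Local Notation vec := 'rV[R]_n.

Definition gram (g : vec -> vec -> vec -> R) (p : vec) : 'M[R]_n :=
  \matrix_(i, j) g p 'e_i 'e_j.

(* Christoffel symbols Gamma^k_ij of the Levi-Civita connection of g.         *)
Definition christoffel (g : vec -> vec -> vec -> R) (p : vec) (i j k : 'I_n)
    : R :=
  2^-1 * \sum_l invmx (gram g p) k l *
    ('D_('e_i) (fun q => gram g q j l) p + 'D_('e_j) (fun q => gram g q i l) p
     - 'D_('e_l) (fun q => gram g q i j) p).

(* nabla_(sigma') sigma' along a curve sigma.                                 *)
Definition cov_accel (g : vec -> vec -> vec -> R) (sigma : R -> vec) (t : R)
    : vec :=
  derive1n 2 sigma t +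
  \row_k \sum_i \sum_j
    christoffel g (sigma t) i j k * (derive1 sigma t 0 i * derive1 sigma t 0 j).

Definition smooth_curve (sigma : R -> vec) : Prop :=
  forall (k : nat) (t : R), derivable (derive1n k sigma) t 1.

(* d omega = 0, evaluated on constant (hence commuting) vector fields.        *)
Definition closed_2form (omega : vec -> vec -> vec -> R) : Prop :=
  forall p u v w : vec,
    'D_u (fun q => omega q v w) p + 'D_v (fun q => omega q w u) p
    + 'D_w (fun q => omega q u v) p = 0.

Definition periodic_curve (sigma : R -> vec) : Prop :=
  exists2 omega : R, omega != 0 & forall t, sigma (t + omega) = sigma t.

End Chart.

Section Heisenberg.
Variable R : realType.
Local Notation h5 := 'rV[R]_5.

(* Coordinates 0, 1, 2, 3, 4 are those along X1, Y1, X2, Y2, Z.               *)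
Definition X1 : h5 := 'e_0.
Definition Y1 : h5 := 'e_1.
Definition X2 : h5 := 'e_2.
Definition Y2 : h5 := 'e_3.
Definition Zc : h5 := 'e_4.

Definition bracket (U V : h5) : h5 :=
  (U 0 0 * V 0 1 - U 0 1 * V 0 0 + (U 0 2 * V 0 3 - U 0 3 * V 0 2)) *: Zc.

Definition inner (U V : h5) : R := \sum_i U 0 i * V 0 i.

Definition vspace_z : {vspace h5} := <[Zc]>%VS.
Definition vspace_v : {vspace h5} := <<[:: X1; Y1; X2; Y2]>>%VS.

(* [n, n]: spanned by the brackets of basis vectors (see bracket_derived).    *)
Definition derived : {vspace h5} :=
  <<[seq bracket 'e_i 'e_j | i <- enum 'I_5, j <- enum 'I_5]>>%VS.

(* jmap Zt V is the Riesz vector of W |-> <Zt, [V, W]> (see jmapP); as Z is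
   central it vanishes for V in z, i.e. this is j(Zt) extended by 0 on z.     *)
Definition jmap (Zt V : h5) : h5 := \row_i inner Zt (bracket V 'e_i).

Definition energy (U : h5) : R := 2^-1 * inner U U.

(* The simply connected group H5: R^5 = h5 in exponential coordinates, with
   the Baker-Campbell-Hausdorff product; the identity is 0 and the inverse
   of p is - p.                                                               *)
Definition mulH (p q : h5) : h5 := p + q + 2^-1 *: bracket p q.

(* The differential at p of the left translation by a.                        *)
Definition dL (a p v : h5) : h5 := 'D_v (mulH a) p.

(* T_p H5 -> T_0 H5 = h5 *)
Definition left_triv (p v : h5) : h5 := dL (- p) p v.

Definition left_inv_field (U p : h5) : h5 := dL p 0 U.

Definition metric (p u v : h5) : R := inner (left_triv p u) (left_triv p v).

(* The left-invariant (1,1)-tensor with value F at the identity.              *)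
Definition left_inv_tensor (F : 'End(h5)) (p v : h5) : h5 :=
  dL p 0 (F (left_triv p v)).

Definition omega_form (F : 'End(h5)) (p u v : h5) : R :=
  metric p (left_inv_tensor F p u) v.

Definition lorentz_force (F : 'End(h5)) : Prop :=
  (forall U V, inner (F U) V = - inner U (F V)) /\
  closed_2form (omega_form F).

Definition type_I (F : 'End(h5)) : Prop :=
  (F @: vspace_v <= vspace_v)%VS /\ (F @: vspace_z <= vspace_z)%VS.

Definition exact_force (F : 'End(h5)) : Prop :=
  exists2 Zt, Zt \in derived & forall U, F U = jmap Zt U.

Definition magnetic_trajectory (F : 'End(h5)) (sigma : R -> h5) : Prop :=
  smooth_curve sigma /\
  forall t, cov_accel metric sigma t
            = left_inv_tensor F (sigma t) (derive1 sigma t).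

Definition curve_energy (sigma : R -> h5) : R :=
  energy (left_triv (sigma 0) (derive1 sigma 0)).

End Heisenberg.

Section HeisenbergTheory.
Variable R : realType.
Local Notation h5 := 'rV[R]_5.

Lemma bracketDl (U1 U2 V : h5) :
  bracket (U1 + U2) V = bracket U1 V + bracket U2 V.
Proof. by rewrite /bracket -scalerDl !mxE; congr (_ *: _); ring. Qed.

Lemma bracketDr (U V1 V2 : h5) :
  bracket U (V1 + V2) = bracket U V1 + bracket U V2.
Proof. by rewrite /bracket -scalerDl !mxE; congr (_ *: _); ring. Qed.

Lemma bracketZl (a : R) (U V : h5) : bracket (a *: U) V = a *: bracket U V.
Proof. by rewrite /bracket scalerA !mxE; congr (_ *: _); ring. Qed.

Lemma bracketZr (a : R) (U V : h5) : bracket U (a *: V) = a *: bracket U V.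
Proof. by rewrite /bracket scalerA !mxE; congr (_ *: _); ring. Qed.

Lemma bracketC (U V : h5) : bracket U V = - bracket V U.
Proof. by rewrite /bracket -[RHS]scaleNr; congr (_ *: _); ring. Qed.

Lemma bracket_Zr (U : h5) : bracket U (Zc R) = 0.
Proof.
by rewrite -[RHS](scale0r (Zc R)) /bracket !mxE /=; congr (_ *: _); ring.
Qed.

Lemma bracket_Zl (U : h5) : bracket (Zc R) U = 0.
Proof. by rewrite bracketC bracket_Zr oppr0. Qed.

Lemma bracketXY1 : bracket (X1 R) (Y1 R) = Zc R.
Proof.
by rewrite -[RHS]scale1r /bracket !mxE /=; congr (_ *: _); ring.
Qed.

Lemma bracketXY2 : bracket (X2 R) (Y2 R) = Zc R.
Proof.
by rewrite -[RHS]scale1r /bracket !mxE /=; congr (_ *: _); ring.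
Qed.

Lemma bracket_derived (U V : h5) : bracket U V \in derived R.
Proof.
apply: memvZ; rewrite -bracketXY1; apply: memv_span.
by apply/allpairsP; exists (0, 1); rewrite /= !mem_enum.
Qed.

Lemma jmapP (Zt V W : h5) : inner Zt (bracket V W) = inner (jmap Zt V) W.
Proof.
rewrite /inner; under [RHS]eq_bigr do rewrite mxE /inner mulr_suml.
rewrite exchange_big /=; apply: eq_bigr => i _.
under [RHS]eq_bigr do rewrite -mulrA.
rewrite -mulr_sumr; congr (_ * _).
have -> : bracket V W = \sum_j W 0 j *: bracket V 'e_j.
  rewrite [W in LHS]row_sum_delta.
  elim/big_rec2: _ => [|j x y _ <-]; last by rewrite bracketDr bracketZr.
  by rewrite -[X in bracket _ X](scale0r 0) bracketZr scale0r.
by rewrite summxE; apply: eq_bigr => j _; rewrite mxE mulrC.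
Qed.

Lemma mulHA : associative (@mulH R).
Proof.
move=> p q r; rewrite /mulH !(bracketDl, bracketDr, bracketZl, bracketZr).
rewrite bracket_Zr bracket_Zl !scaler0 !addr0 !scalerDr.
by apply/rowP => i; rewrite !mxE; ring.
Qed.

Lemma mul0H : left_id 0 (@mulH R).
Proof.
move=> p; rewrite /mulH -[X in bracket X](scale0r 0) bracketZl scale0r.
by rewrite scaler0 addr0 add0r.
Qed.

Lemma mulNH (p : h5) : mulH (- p) p = 0.
Proof.
rewrite /mulH addNr add0r /bracket -[RHS](scale0r (Zc R)) scalerA.
by rewrite !mxE; congr (_ *: _); ring.
Qed.

Lemma is_derive_affine (f : h5 -> h5) (p v w : h5) :
  (forall h, f (h *: v + p) - f p = h *: w) -> is_derive p v f w.
Proof.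
move=> fE.
have cvgf : (h^-1 *: (f (h *: v + p) - f p) @[h --> 0^'] --> w)%classic.
  apply: cvg_near_cst; near=> h.
  rewrite fE scalerA mulVf ?scale1r //.
  by near: h; exact: nbhs_dnbhs_neq.
apply: DeriveDef; first by apply/cvg_ex; exists w.
exact: cvg_lim.
Unshelve. all: by end_near. Qed.

Lemma is_derive_mulH (a p v : h5) :
  is_derive p v (mulH a) (v + 2^-1 *: bracket a v).
Proof.
apply: is_derive_affine => h; rewrite /mulH bracketDr bracketZr.
by apply/rowP => i; rewrite !mxE; ring.
Qed.

Lemma dLE (a p v : h5) : dL a p v = v + 2^-1 *: bracket a v.
Proof. by have [_ <-] := is_derive_mulH a p v. Qed.

Lemma metric_left_inv (a p u v : h5) :
  metric (mulH a p) (dL a p u) (dL a p v) = metric p u v.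
Proof.
rewrite /metric /left_triv.
suff H w : dL (- mulH a p) (mulH a p) (dL a p w) = dL (- p) p w by rewrite (H u) (H v).
rewrite (dLE a p w) (dLE (- p) p w) dLE.
apply/rowP => i; rewrite !mxE /=.
by ring.
Qed.

Lemma gram_unit (p : h5) : gram (@metric R) p \in unitmx.
Proof.
pose M : 'M[R]_5 := \matrix_i (2^-1 *: bracket p 'e_i).
have M2 : M *m M = 0.
  apply/matrixP => i j; rewrite !mxE big1 // => k _.
  rewrite [M i k]mxE [M k j]mxE !mxE.
  have [->|_] := eqVneq k 4; last by rewrite !mulr0 mul0r.
  by rewrite /=; ring.
have unitM (N : 'M[R]_5) : N *m N = 0 -> 1%:M + N \in unitmx.
  move=> N2; suff /mulmx1_unit[] : (1%:M + N) *m (1%:M - N) = 1%:M by [].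
  by rewrite mulmxBr mulmx1 mulmxDl mul1mx N2 addr0 addrK.
have U : 1%:M - M \in unitmx by apply: unitM; rewrite mulNmx mulmxN opprK.
suff -> : gram (@metric R) p = (1%:M - M) *m (1%:M - M)^T.
  by rewrite unitmx_mul unitmx_tr U.
apply/matrixP => i j; rewrite !mxE /metric /inner; apply: eq_bigr => k _.
rewrite /left_triv (dLE (- p) p 'e_i) (dLE (- p) p 'e_j) !mxE /=.
by rewrite ![_ == k]eq_sym; ring.
Qed.

(* The left-invariant fields on the group close under the Lie bracket of
   vector fields as prescribed by h5.                                         *)
Lemma left_inv_fieldLie (U V p : h5) :
  'D_(left_inv_field U p) (left_inv_field V) p
  - 'D_(left_inv_field V p) (left_inv_field U) p
  = left_inv_field (bracket U V) p.
Proof.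
have D W w : 'D_w (left_inv_field W) p = 2^-1 *: bracket w W.
  suff [_ ->] : is_derive p w (left_inv_field W) (2^-1 *: bracket w W) by [].
  apply: is_derive_affine => h; rewrite /left_inv_field !dLE bracketDl bracketZl.
  by apply/rowP => i; rewrite !mxE; ring.
rewrite (D V) (D U) /left_inv_field (dLE p 0 U) (dLE p 0 V) dLE.
by apply/rowP => i; rewrite !mxE /=; field.
Qed.

End HeisenbergTheory.

(* Main.v *)
Require Import Defs.
From mathcomp Require Import all_boot all_order all_algebra.
From mathcomp Require Import all_classical all_reals all_analysis.
From mathcomp Require Import ring lra.
Set Implicit Arguments.
Unset Strict Implicit.
Unset Printing Implicit Defensive.

Import Order.TTheory GRing.Theory Num.Theory.
Import numFieldNormedType.Exports.

(** Left-translate the velocity of a curve sigma in H5 to the identity, u(t).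
    The Levi-Civita acceleration, translated in the same way, is u' - j(u)u,
    where j(u) only sees the central component of u ([cov_accelE]).  For a force
    that kills the centre, a magnetic trajectory therefore has a constant
    central velocity z and a horizontal velocity that solves the linear equation
    v' = (z J + F) v, with J = j(Z).

    On v = C^2, with J as multiplication by i, F is skew and commutes with J, so
    it lies in u(2): it has orthonormal eigenvectors P1, P2 with
    F P_k = t_k J P_k.  If t1 = t2 then F = t1 J is exact; hence t1 and t2
    differ ([unitary_spectrum]).  The horizontal motion in the line of P_k is a
    circle of frequency z + t_k.

    The trajectories used are the ellipses cos(l t) A + sin(l t) B with A and B
    horizontal.  Their Z-coordinate vanishes, they have period 2 pi / l, and
    they are magnetic as soon as A and B solve an algebraic system
    ([osc_magnetic]).  The area form takes a constant value along such an
    ellipse, which is what makes the central velocity constant; requiring it to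
    compensate the drift z is a second condition on A and B.

    Let a and b be the squared lengths of the components of the initial
    horizontal velocity along P1 and P2.  What remains is to solve, for the
    given E, scalar equations in z, l, a, b ([energy_level]).  When z is midway
    between - t1 and - t2 the two frequencies are opposite, so both eigenlines
    can be used at once; this reaches every energy above a threshold.  Motion in
    a single eigenline reaches every E with 2 E < t_k^2.  Since t1 and t2
    differ, these ranges overlap and cover all E >= 0. *)

Local Open Scope ring_scope.

(** * Coordinates on h5 *)

Lemma h5P (R : realType) (U V : 'rV[R]_5) :
  U 0 0 = V 0 0 -> U 0 1 = V 0 1 -> U 0 2 = V 0 2 -> U 0 3 = V 0 3 ->
  U 0 4 = V 0 4 -> U = V.
Proof.
move=> e0 e1 e2 e3 e4; apply/rowP => -[[|[|[|[|[|//]]]]] i_lt];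
  [move: e0 | move: e1 | move: e2 | move: e3 | move: e4];
  by congr (U 0 _ = V 0 _); apply: val_inj.
Qed.

Lemma innerE (R : realType) (U V : 'rV[R]_5) :
  inner U V = U 0 0 * V 0 0 + U 0 1 * V 0 1 + U 0 2 * V 0 2 + U 0 3 * V 0 3
              + U 0 4 * V 0 4.
Proof.
rewrite /inner !big_ord_recr big_ord0 /= add0r.
by congr (U 0 _ * V 0 _ + U 0 _ * V 0 _ + U 0 _ * V 0 _ + U 0 _ * V 0 _
          + U 0 _ * V 0 _); apply: val_inj.
Qed.

(** The Z-component of the bracket: the standard symplectic form on v. *)
Definition symp (R : realType) (U V : 'rV[R]_5) : R :=
  U 0 0 * V 0 1 - U 0 1 * V 0 0 + (U 0 2 * V 0 3 - U 0 3 * V 0 2).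

Lemma inner_bracket (R : realType) (W U V : 'rV[R]_5) :
  inner W (bracket U V) = W 0 4 * symp U V.
Proof. by rewrite innerE /bracket /symp !mxE /=; ring. Qed.

Lemma jmapE (R : realType) (W U : 'rV[R]_5) :
  jmap W U = W 0 4 *: \row_i [:: - U 0 1; U 0 0; - U 0 3; U 0 2; 0]`_i.
Proof.
by apply: h5P; rewrite !mxE inner_bracket /symp !mxE /=; ring.
Qed.

(** * The Levi-Civita connection in left-invariant terms *)

Lemma left_trivE (R : realType) (p u : 'rV[R]_5) :
  left_triv p u = u - 2^-1 *: bracket p u.
Proof.
by rewrite /left_triv dLE -scaleN1r bracketZl scaleN1r scalerN.
Qed.

Lemma left_triv_dL (R : realType) (p u : 'rV[R]_5) :
  left_triv p (dL p 0 u) = u.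
Proof.
rewrite left_trivE dLE; apply/rowP => i.
by rewrite /bracket !mxE /=; ring.
Qed.

Lemma dL_left_triv (R : realType) (p u : 'rV[R]_5) :
  dL p 0 (left_triv p u) = u.
Proof.
rewrite left_trivE dLE; apply/rowP => i.
by rewrite /bracket !mxE /=; ring.
Qed.

Lemma dLD (R : realType) (p q u v : 'rV[R]_5) :
  dL p q (u + v) = dL p q u + dL p q v.
Proof. by rewrite !dLE bracketDr scalerDr addrACA. Qed.

(** The left-invariant contact form at p, dual to Z. *)
Definition contact (R : realType) (p u : 'rV[R]_5) : R :=
  u 0 4 - 2^-1 * symp p u.

Lemma left_triv4 (R : realType) (p u : 'rV[R]_5) :
  left_triv p u 0 4 = contact p u.
Proof. by rewrite left_trivE /bracket !mxE mulr1. Qed.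

(** Left translation does not change the horizontal coordinates of a vector, so
    the metric is the Euclidean one on v plus the square of the contact form. *)
Lemma metricE (R : realType) (p u v : 'rV[R]_5) :
  metric p u v = u 0 0 * v 0 0 + u 0 1 * v 0 1 + u 0 2 * v 0 2 + u 0 3 * v 0 3
                 + contact p u * contact p v.
Proof.
rewrite -!left_triv4 /metric innerE.
congr (_ * _ + _ * _ + _ * _ + _ * _ + _);
  by rewrite left_trivE /bracket !mxE /= !mulr0 subr0.
Qed.

Lemma linear_form_sum (R : realType) (n : nat) (f : 'rV[R]_n -> R)
    (s : 'rV[R]_n) :
  (forall a u v, f (a *: u + v) = a * f u + f v) ->
  \sum_i s 0 i * f 'e_i = f s.
Proof.
move=> fl; rewrite [s in RHS]row_sum_delta.
have f0 : f 0 = 0 by have := fl (-1) 0 0; rewrite scaler0 addr0 mulN1r addNr.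
by elim/big_rec2: _ => [|i x y _ ->]; rewrite ?f0 ?fl.
Qed.

(** The coefficients of the metric are quadratic in the point; along a line,
    the derivative is the coefficient of h. *)
Lemma is_derive_quadratic (R : realType) (V : normedModType R) (f : V -> R)
    (p v : V) (a b : R) :
  (forall h, f (h *: v + p) - f p = h * a + h ^+ 2 * b) -> is_derive p v f a.
Proof.
move=> fE.
have cvgf : (h^-1 *: (f (h *: v + p) - f p) @[h --> 0^'] --> a)%classic.
  have cvga : ((fun h : R => a + h * b) h @[h --> 0^'] --> a + 0 * b)%classic.
    apply: cvgD; first exact: cvg_cst.
    by apply: cvgM; [exact: nbhs_dnbhs | exact: cvg_cst].
  rewrite mul0r addr0 in cvga; apply: cvg_trans cvga; apply: near_eq_cvg.
  near=> h; rewrite fE expr2 -mulrA -mulrDr.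
  rewrite /GRing.scale /= mulKf //.
  by near: h; exact: nbhs_dnbhs_neq.
apply: DeriveDef; first by apply/cvg_ex; exists a.
exact: cvg_lim.
Unshelve. all: by end_near. Qed.

Lemma is_derive_metric (R : realType) (p w u v : 'rV[R]_5) :
  is_derive p w (fun q => metric q u v)
    (- 2^-1 * (symp w u * contact p v + contact p u * symp w v)).
Proof.
apply: (@is_derive_quadratic _ _ _ _ _ _ (4^-1 * (symp w u * symp w v))) => h.
rewrite !metricE /contact /symp !mxE.
by field.
Qed.

(** Christoffel symbols of the first kind, contracted twice with the velocity.
    Each derivative of the metric is a symmetric product of the contact form with
    the symplectic form.  After contraction with s s the terms containing
    symp s s cancel by antisymmetry and the four others are equal. *)
Lemma christoffel_lowered (R : realType) (p s : 'rV[R]_5) (l : 'I_5) :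
  2^-1 * \sum_i \sum_j
    ('D_('e_i) (fun q => gram (@metric R) q j l) p
     + 'D_('e_j) (fun q => gram (@metric R) q i l) p
     - 'D_('e_l) (fun q => gram (@metric R) q i j) p) * (s 0 i * s 0 j)
  = - contact p s * symp s 'e_l.
Proof.
have D (i j k : 'I_5) : 'D_('e_i) (fun q => gram (@metric R) q j k) p =
    - 2^-1 * (symp 'e_i 'e_j * contact p 'e_k
              + contact p 'e_j * symp 'e_i 'e_k).
  under eq_fun do rewrite mxE.
  by have [_ ->] := is_derive_metric p 'e_i 'e_j 'e_k.
have sympC (u v : 'rV[R]_5) : symp u v = - symp v u by rewrite /symp; ring.
rewrite -(@linear_form_sum R 5 (fun u => contact p u) s); last first.
  by move=> a u v; rewrite /contact /symp !mxE; ring.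
rewrite -(@linear_form_sum R 5 (fun u => symp u 'e_l) s); last first.
  by move=> a u v; rewrite /symp !mxE; ring.
set th := fun i => s 0 i * contact p 'e_i.
set om := fun i => s 0 i * symp 'e_i 'e_l.
transitivity (2^-1 * \sum_i \sum_j (- (om i * th j) - th i * om j)).
  congr (_ * _); apply: eq_bigr => i _; apply: eq_bigr => j _.
  rewrite !D (sympC 'e_j 'e_i) (sympC 'e_l 'e_i) (sympC 'e_l 'e_j) /th /om.
  by field.
under eq_bigr do rewrite sumrB sumrN.
rewrite sumrB sumrN -!big_distrlr /=.
by field.
Qed.

(** The Euler-Arnold form of the covariant acceleration of an arbitrary curve:
    if u is the left-translated velocity, the left translate of the second
    derivative is u', because the bracket of the velocity with itself vanishes,
    and the Christoffel terms contribute - j(u)u. *)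
Lemma cov_accelE (R : realType) (sigma : R -> 'rV[R]_5) (t : R) :
  cov_accel (@metric R) sigma t =
  dL (sigma t) 0
    (left_triv (sigma t) (derive1n 2 sigma t)
     - jmap (left_triv (sigma t) (derive1 sigma t))
            (left_triv (sigma t) (derive1 sigma t))).
Proof.
rewrite /cov_accel.
set p := sigma t; set s := derive1 sigma t; set a := derive1n 2 sigma t.
set u := left_triv p s.
pose g := gram (@metric R) p.
pose c : 'rV[R]_5 := \row_l (- u 0 4 * symp s 'e_l).
have gT : g^T = g.
  by apply/matrixP => i j; rewrite 3!mxE !metricE; ring.
(* Lower the index: c is the Gram matrix applied to the expected vector. *)
have cE : c = dL p 0 (- jmap u u) *m g.
  apply/rowP => l; rewrite !mxE.
  under eq_bigr do rewrite [g _ _]mxE.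
  rewrite (@linear_form_sum R 5 (fun v => metric p v 'e_l)); last first.
    by move=> k v w; rewrite !metricE /contact /symp !mxE; ring.
  rewrite /metric left_triv_dL.
  have -> : inner (- jmap u u) (left_triv p 'e_l)
            = - inner (jmap u u) (left_triv p 'e_l).
    by rewrite !innerE !mxE; ring.
  rewrite -jmapP inner_bracket mulNr; congr (- (_ * _)).
  by rewrite /u !left_trivE /symp /bracket !mxE /=; ring.
have -> : (\row_k \sum_i \sum_j
    christoffel (@metric R) p i j k * (s 0 i * s 0 j)) = c *m invmx g.
  apply/rowP => k; rewrite !mxE.
  under [RHS]eq_bigr do
    rewrite mxE /u left_triv4 -christoffel_lowered mulrC.
  transitivity (\sum_i \sum_j \sum_l 2^-1 * (s 0 i * s 0 j) *
    (invmx g k l * ('D_('e_i) (fun q => gram (@metric R) q j l) p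
     + 'D_('e_j) (fun q => gram (@metric R) q i l) p
     - 'D_('e_l) (fun q => gram (@metric R) q i j) p))).
    apply: eq_bigr => i _; apply: eq_bigr => j _.
    by rewrite /christoffel mulrAC mulr_sumr.
  under [LHS]eq_bigr do rewrite exchange_big.
  rewrite exchange_big /=; apply: eq_bigr => l _.
  rewrite !mulr_sumr; apply: eq_bigr => i _.
  rewrite !mulr_sumr; apply: eq_bigr => j _.
  have -> : invmx g l k = invmx g k l by rewrite -[in LHS]gT -trmx_inv mxE.
  by rewrite /g; ring.
by rewrite cE mulmxK ?gram_unit // dLD dL_left_triv.
Qed.

(** * Elliptic magnetic trajectories *)

Lemma is_derive_scaler (R : realType) (V : normedModType R) (g : R -> R)
    (A : V) (t dg : R) :
  is_derive t 1 g dg -> is_derive t 1 (fun u => g u *: A) (dg *: A).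
Proof.
move=> [g_der gE].
have cvgg : (h^-1 *: (g (h *: 1 + t) *: A - g t *: A) @[h --> 0^']
             --> dg *: A)%classic.
  under eq_fun do rewrite -scalerBl scalerA.
  by apply: cvgZr_tmp; rewrite -gE; exact: g_der.
apply: DeriveDef; first by apply/cvg_ex; exists (dg *: A).
exact: cvg_lim.
Qed.

Definition osc (R : realType) (l : R) (A B : 'rV[R]_5) (t : R) : 'rV[R]_5 :=
  cos (l * t) *: A + sin (l * t) *: B.

Lemma is_derive_osc (R : realType) (l : R) (A B : 'rV[R]_5) (t : R) :
  is_derive t 1 (osc l A B) (osc l (l *: B) (- l *: A) t).
Proof.
have der_lin : is_derive t 1 (fun u : R => l * u) l.
  by apply: (@is_derive_quadratic _ _ _ _ _ _ 0) => h; rewrite /GRing.scale /=; ring.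
have -> : osc l (l *: B) (- l *: A) t =
    (- sin (l * t) * l) *: A + (cos (l * t) * l) *: B.
  by apply/rowP => i; rewrite /osc !mxE /=; ring.
by apply: is_deriveD; apply: is_derive_scaler.
Qed.

Lemma derive1_osc (R : realType) (l : R) (A B : 'rV[R]_5) :
  derive1 (osc l A B) = osc l (l *: B) (- l *: A).
Proof.
apply/funext => t; rewrite derive1E.
by have [_ ->] := is_derive_osc l A B t.
Qed.

Lemma smooth_osc (R : realType) (l : R) (A B : 'rV[R]_5) :
  smooth_curve (osc l A B).
Proof.
move=> k t.
suff [C [D ->]] : exists C D, derive1n k (osc l A B) = osc l C D.
  by have [] := is_derive_osc l C D t.
elim: k => [|k [C [D IH]]]; first by exists A, B.
by exists (l *: D), (- l *: C); rewrite -derive1_osc -IH.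
Qed.

Lemma periodic_osc (R : realType) (l : R) (A B : 'rV[R]_5) :
  l != 0 -> periodic_curve (osc l A B).
Proof.
move=> l0; exists ((pi *+ 2) / l).
  by rewrite mulf_neq0 ?invr_eq0 // mulrn_eq0 /= gt_eqF // pi_gt0.
move=> t; rewrite /osc mulrDr [l * (_ / l)]mulrC divfK //.
by rewrite sinD2pi cosD2pi.
Qed.

Lemma jmapD (R : realType) (W U V : 'rV[R]_5) :
  jmap W (U + V) = jmap W U + jmap W V.
Proof. by rewrite !jmapE; apply: h5P; rewrite !mxE /=; ring. Qed.

Lemma jmapZ (R : realType) (W U : 'rV[R]_5) (a : R) :
  jmap W (a *: U) = a *: jmap W U.
Proof. by rewrite !jmapE; apply: h5P; rewrite !mxE /=; ring. Qed.

Lemma jmap_Zc (R : realType) (W U : 'rV[R]_5) :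
  jmap W U = W 0 4 *: jmap (Zc R) U.
Proof. by rewrite !jmapE /Zc !mxE scale1r. Qed.

Lemma jmap_central (R : realType) (W : 'rV[R]_5) : jmap W (Zc R) = 0.
Proof. by rewrite !jmapE; apply: h5P; rewrite !mxE /=; ring. Qed.

(** The symplectic form of an ellipse with its derivative is constant in time
    (equal areas in equal times), so for horizontal A and B the left velocity has
    a constant central component. *)
Lemma left_velocity_osc (R : realType) (l : R) (A B : 'rV[R]_5) (t : R) :
  left_triv (osc l A B t) (derive1 (osc l A B) t) =
  derive1 (osc l A B) t + (- 2^-1 * l * symp A B) *: Zc R.
Proof.
rewrite left_trivE derive1_osc /bracket scalerA -scaleNr; congr (_ + _ *: _).
have cs := cos2Dsin2 (l * t).
transitivity (- 2^-1 * l * symp A B * (cos (l * t) ^+ 2 + sin (l * t) ^+ 2)).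
  by rewrite /osc /symp !mxE; ring.
by rewrite cs mulr1.
Qed.

Section MagneticCircle.
Variables (R : realType) (F : 'End('rV[R]_5)) (l z : R) (A B : 'rV[R]_5).
Hypothesis FZ0 : F (Zc R) = 0.
Hypothesis A4 : A 0 4 = 0.
Hypothesis B4 : B 0 4 = 0.
Hypothesis zE : z = - 2^-1 * l * symp A B.

(** The second derivative is - l^2 times the position, so its bracket with the
    position vanishes and it is its own left translate; the magnetic equation
    then reduces to the two linear conditions, one for the coefficient of cos and
    one for that of sin. *)
Lemma osc_magnetic :
  z *: jmap (Zc R) A + F A = l *: B ->
  z *: jmap (Zc R) B + F B = - l *: A ->
  magnetic_trajectory F (osc l A B).
Proof.
move=> eqA eqB; split; first exact: smooth_osc.
move=> t; rewrite cov_accelE /left_inv_tensor; congr (dL _ 0 _).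
rewrite left_velocity_osc -zE.
have -> : left_triv (osc l A B t) (derive1n 2 (osc l A B) t)
          = - l ^+ 2 *: osc l A B t.
  have -> : derive1n 2 (osc l A B) t = - l ^+ 2 *: osc l A B t.
    rewrite /derive1n /= !derive1_osc /osc.
    by apply/rowP => i; rewrite !mxE; ring.
  rewrite left_trivE bracketZr (_ : bracket _ _ = 0) ?scaler0 ?subr0 //.
  by rewrite /bracket -[RHS](scale0r (Zc R)); congr (_ *: _); ring.
set s := derive1 (osc l A B) t.
have sE : s = osc l (l *: B) (- l *: A) t by rewrite /s derive1_osc.
have s4 : s 0 4 = 0 by rewrite sE /osc !mxE A4 B4 !mulr0 addr0.
have u4 : (s + z *: Zc R) 0 4 = z by rewrite mxE s4 add0r !mxE mulr1.
have Fu : F (s + z *: Zc R) = F s by rewrite linearD linearZ /= FZ0 scaler0 addr0.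
have Ju : jmap (Zc R) (s + z *: Zc R) = jmap (Zc R) s.
  by rewrite jmapD jmapZ jmap_central scaler0 addr0.
rewrite jmap_Zc u4 Fu Ju.
have FA : F A = l *: B - z *: jmap (Zc R) A by rewrite -eqA addrAC subrr add0r.
have FB : F B = - l *: A - z *: jmap (Zc R) B by rewrite -eqB addrAC subrr add0r.
have -> : F s = (cos (l * t) * l) *: F B - (sin (l * t) * l) *: F A.
  by rewrite sE /osc linearD !linearZ /=; apply/rowP => i; rewrite !mxE; ring.
rewrite sE /osc jmapD !jmapZ FA FB.
by apply/rowP => i; rewrite !mxE; ring.
Qed.

Lemma osc_energy :
  curve_energy (osc l A B) = 2^-1 * (l ^+ 2 * inner B B + z ^+ 2).
Proof.
rewrite /curve_energy left_velocity_osc -zE derive1_osc /osc /energy !innerE.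
by rewrite !mulr0 cos0 sin0 /Zc !mxE /= A4 B4; ring.
Qed.

End MagneticCircle.

(** * Energy levels *)

(** Motion in a single eigenline of frequency z + th: the equations for the
    energy and for zero drift combine to (z + th)^2 = th^2 - 2 E.  The root nearer
    to 0 is chosen, so that z (z + th) <= 0 and hence a >= 0. *)
Lemma low_energy_level (R : realType) (th E : R) :
  0 <= E -> 2 * E < th ^+ 2 ->
  exists z a : R, [/\ z + th != 0, 0 <= a, a + z ^+ 2 = 2 * E
                    & a = - 2 * z * (z + th)].
Proof.
move=> E0 Eth; set r := Num.sqrt (th ^+ 2 - 2 * E).
have d0 : 0 < th ^+ 2 - 2 * E by rewrite subr_gt0.
have r0 : 0 < r by rewrite sqrtr_gt0.
have r2 : r ^+ 2 = th ^+ 2 - 2 * E by rewrite sqr_sqrtr // ltW.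
have rth : r <= `|th|.
  by rewrite -[`|th|]sqrtr_sqr ler_sqrt ?sqr_ge0 //; lra.
have [th0|th0] := lerP 0 th.
  rewrite ger0_norm // in rth.
  exists (- th + r), (- 2 * (- th + r) * r); split.
  - by rewrite addrAC addNr add0r gt_eqF.
  - nra.
  - nra.
  - by ring.
rewrite ltr0_norm // in rth.
exists (- th - r), (2 * (- th - r) * r); split.
- by rewrite addrAC addNr add0r oppr_eq0 gt_eqF.
- nra.
- nra.
- by ring.
Qed.

(** The mean choice z = - (t1 + t2) / 2 gives the opposite frequencies l and - l
    with l = (t1 - t2) / 2; zero drift and energy then determine a and b.  One of
    them is negative exactly when 2 E is below t_k^2 - l^2 for some k, and then
    the single eigenline k suffices. *)
Lemma energy_level (R : realType) (th1 th2 E : R) :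
  th1 != th2 -> 0 <= E ->
  exists z l a b : R,
    [/\ l != 0, 0 <= a, 0 <= b &
    [/\ a + b + z ^+ 2 = 2 * E,
        2 * z * l ^+ 2 + (z + th1) * a + (z + th2) * b = 0,
        a * (z + th1) ^+ 2 = a * l ^+ 2 & b * (z + th2) ^+ 2 = b * l ^+ 2]].
Proof.
move=> th12 E0.
pose z := - (th1 + th2) / 2; pose l := (th1 - th2) / 2.
have l0 : l != 0 by rewrite mulf_neq0 ?subr_eq0 ?invr_eq0 ?pnatr_eq0.
have l2 : 0 < l ^+ 2 by rewrite exprn_even_gt0.
have zl1 : z ^+ 2 - 2 * z * l = th1 ^+ 2 - l ^+ 2 by rewrite /z /l; field.
have zl2 : z ^+ 2 + 2 * z * l = th2 ^+ 2 - l ^+ 2 by rewrite /z /l; field.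
have [E1|E1] := ltP (2 * E) (z ^+ 2 + 2 * z * l).
  have [|z' [b [zth b0 bE bz]]] := @low_energy_level R th2 E E0; first lra.
  exists z', (z' + th2), 0, b; split=> //.
  by split; rewrite ?add0r ?bE // ?bz; ring.
have [E2|E2] := ltP (2 * E) (z ^+ 2 - 2 * z * l).
  have [|z' [a [zth a0 aE az]]] := @low_energy_level R th1 E E0; first lra.
  exists z', (z' + th1), a, 0; split=> //.
  by split; rewrite ?addr0 ?aE // ?az; ring.
exists z, l, ((2 * E - z ^+ 2 - 2 * z * l) / 2), ((2 * E - z ^+ 2 + 2 * z * l) / 2).
split=> //; [lra | lra | split].
- by field.
- by rewrite /z /l; field.
- by rewrite /z /l; field.
- by rewrite /z /l; field.
Qed.

(** * Spectral theory of the force *)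

Lemma innerDl (R : realType) (U V W : 'rV[R]_5) :
  inner (U + V) W = inner U W + inner V W.
Proof. by rewrite !innerE !mxE; ring. Qed.

Lemma innerZl (R : realType) (a : R) (U V : 'rV[R]_5) :
  inner (a *: U) V = a * inner U V.
Proof. by rewrite !innerE !mxE; ring. Qed.

Lemma innerC (R : realType) (U V : 'rV[R]_5) : inner U V = inner V U.
Proof. by rewrite !innerE; ring. Qed.

Lemma innerZr (R : realType) (a : R) (U V : 'rV[R]_5) :
  inner U (a *: V) = a * inner U V.
Proof. by rewrite innerC innerZl innerC. Qed.

Lemma innerNr (R : realType) (U V : 'rV[R]_5) : inner U (- V) = - inner U V.
Proof. by rewrite -scaleN1r innerZr mulN1r. Qed.

Lemma inner_gt0 (R : realType) (U : 'rV[R]_5) : U != 0 -> 0 < inner U U.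
Proof.
move=> U0; have : \sum_i U 0 i * U 0 i != 0.
  apply: contraNN U0; rewrite psumr_eq0 => [|i _]; last by rewrite -expr2 sqr_ge0.
  move=> /allP U0; apply/eqP/rowP => i; rewrite mxE; apply/eqP.
  by have := U0 i (mem_index_enum i); rewrite /= mulf_eq0 orbb.
by rewrite lt0r /inner => ->; apply: sumr_ge0 => i _; rewrite -expr2 sqr_ge0.
Qed.

Lemma symp_jmap (R : realType) (U V : 'rV[R]_5) :
  symp U V = inner (jmap (Zc R) U) V.
Proof. by rewrite -jmapP inner_bracket /Zc !mxE mul1r. Qed.

Lemma jmapK (R : realType) (U : 'rV[R]_5) :
  U 0 4 = 0 -> jmap (Zc R) (jmap (Zc R) U) = - U.
Proof.
by move=> U4; rewrite !jmapE; apply: h5P; rewrite /Zc !mxE /= ?U4; ring.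
Qed.

Lemma jmap_skew (R : realType) (U V : 'rV[R]_5) :
  inner (jmap (Zc R) U) V = - inner U (jmap (Zc R) V).
Proof. by rewrite -symp_jmap innerC -symp_jmap /symp; ring. Qed.

Lemma jmap4 (R : realType) (W U : 'rV[R]_5) : jmap W U 0 4 = 0.
Proof. by rewrite jmapE !mxE /= mulr0. Qed.

(** Multiplication by the skew-Hermitian matrix with rows (i a, c + i d) and
    (- c + i d, i b), in the complex coordinates x1 + i y1 and x2 + i y2 of v. *)
Definition skew_hermitian (R : realType) (a b c d : R) (U : 'rV[R]_5) :
  'rV[R]_5 :=
  \row_i [:: - a * U 0 1 + c * U 0 2 - d * U 0 3;
             a * U 0 0 + c * U 0 3 + d * U 0 2;
             - c * U 0 0 - d * U 0 1 - b * U 0 3;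
             d * U 0 0 - c * U 0 1 + b * U 0 2; 0]`_i.

Section UnitaryForce.
Variables (R : realType) (F : 'End('rV[R]_5)).
Local Notation J := (jmap (Zc R)).
Hypothesis Fskew : forall U V, inner (F U) V = - inner U (F V).
Hypothesis FZ0 : F (Zc R) = 0.
Hypothesis FJ : forall V : 'rV[R]_5, V 0 4 = 0 -> F (J V) = J (F V).

Lemma force4 (V : 'rV[R]_5) : F V 0 4 = 0.
Proof.
have -> : F V 0 4 = inner (F V) (Zc R) by rewrite innerE /Zc !mxE /=; ring.
by rewrite Fskew FZ0 innerE !mxE; ring.
Qed.

(** F commutes with J, so it is determined by the images of X1 and X2; skewness
    makes the diagonal entries imaginary and relates the two off-diagonal ones. *)
Lemma unitary_coord : exists a b c d : R, forall U, F U = skew_hermitian a b c d U.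
Proof.
have FE (U : 'rV[R]_5) : F U = U 0 0 *: F 'e_0 + U 0 1 *: F 'e_1
    + U 0 2 *: F 'e_2 + U 0 3 *: F 'e_3.
  have UE : U = U 0 0 *: 'e_0 + U 0 1 *: 'e_1 + U 0 2 *: 'e_2 + U 0 3 *: 'e_3
                + U 0 4 *: Zc R.
    by apply: h5P; rewrite /Zc !mxE /=; ring.
  by rewrite {1}UE !linearD !linearZ /= FZ0 scaler0 addr0.
have skew i j : F 'e_i 0 j = - F 'e_j 0 i.
  have inner_e (U : 'rV[R]_5) k : inner U 'e_k = U 0 k.
    rewrite /inner (bigD1 k) //= big1 ?addr0 ?mxE ?eqxx ?mulr1 // => m mk.
    by rewrite mxE (negPf mk) mulr0.
  by rewrite -[LHS]inner_e Fskew innerC inner_e.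
have diag i : F 'e_i 0 i = 0 by have := skew i i; lra.
have Je0 : 'e_1 = J 'e_0.
  by rewrite jmapE; apply: h5P; rewrite /Zc !mxE /=; ring.
have Je2 : 'e_3 = J 'e_2.
  by rewrite jmapE; apply: h5P; rewrite /Zc !mxE /=; ring.
have F1 : F 'e_1 = J (F 'e_0) by rewrite Je0 FJ // mxE.
have F3 : F 'e_3 = J (F 'e_2) by rewrite Je2 FJ // mxE.
exists (F 'e_0 0 1), (F 'e_2 0 3), (- F 'e_0 0 2), (F 'e_0 0 3) => U.
rewrite FE F1 F3 /skew_hermitian !jmapE.
apply: h5P; rewrite /Zc !mxE /= ?force4 ?diag;
  rewrite ?(skew 2 0) ?(skew 2 1) ?F1 ?jmapE /Zc ?mxE /=; ring.
Qed.

(** The first hypothesis on th says that i th is a root of the characteristic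
    polynomial, and the second that it is a simple one.  The adjugate of
    i th - F is then nonzero and its columns, up to the factor i, are
    eigenvectors; the two candidates below are these columns. *)
Lemma unitary_eigenvector (a b c d th : R) :
  (forall U, F U = skew_hermitian a b c d U) ->
  (th - a) * (th - b) = c ^+ 2 + d ^+ 2 ->
  2 * th != a + b ->
  exists P : 'rV[R]_5, [/\ inner P P = 1, P 0 4 = 0 & F P = th *: J P].
Proof.
move=> FE thE th_ab.
suff [P [P0 P4 PE]] : exists P : 'rV[R]_5, [/\ P != 0, P 0 4 = 0 & F P = th *: J P].
  have P_gt0 := inner_gt0 P0.
  exists ((Num.sqrt (inner P P))^-1 *: P); split.
  - rewrite innerZl innerZr mulrA -expr2 exprVn sqr_sqrtr ?ltW //.
    by rewrite mulVf // gt_eqF.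
  - by rewrite mxE P4 mulr0.
  - by rewrite linearZ /= PE jmapZ scalerA mulrC -scalerA.
have [tb|tb] := eqVneq th b; last first.
  exists (\row_i [:: th - b; 0; d; c; 0]`_i); split.
  - apply: contraNneq tb => /rowP/(_ 0); rewrite !mxE /= => /eqP.
    by rewrite subr_eq0.
  - by rewrite mxE.
  - rewrite FE /skew_hermitian jmapE; apply: h5P; rewrite /Zc !mxE /=;
      by move: thE; nra.
exists (\row_i [:: d; - c; th - a; 0; 0]`_i); split.
- apply: contraNneq th_ab => /rowP/(_ 2); rewrite !mxE /= => ta.
  by apply/eqP; rewrite -tb; lra.
- by rewrite mxE.
- rewrite FE /skew_hermitian jmapE; apply: h5P; rewrite /Zc !mxE /=;
    by move: thE; nra.
Qed.

(** The eigenvalues are (a + b) / 2 plus or minus the square root of the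
    discriminant D.  If D = 0 the matrix is scalar, that is F = a J is exact. *)
Lemma unitary_spectrum : ~ exact_force F ->
  exists (t1 t2 : R) (P1 P2 : 'rV[R]_5), [/\ t1 != t2,
    [/\ inner P1 P1 = 1, P1 0 4 = 0 & F P1 = t1 *: J P1] &
    [/\ inner P2 P2 = 1, P2 0 4 = 0 & F P2 = t2 *: J P2]].
Proof.
move=> Fex; have [a [b [c [d FE]]]] := unitary_coord.
pose D := ((a - b) / 2) ^+ 2 + c ^+ 2 + d ^+ 2.
have D0 : 0 < D.
  rewrite lt0r; apply/andP; split; last by rewrite !addr_ge0 ?sqr_ge0.
  apply/eqP => D0; apply: Fex; exists (a *: Zc R).
    by apply: memvZ; rewrite -bracketXY1 bracket_derived.
  move/eqP: D0; rewrite /D !paddr_eq0 ?addr_ge0 ?sqr_ge0 // !sqrf_eq0.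
  move=> /andP[/andP[/eqP ab0 /eqP c0] /eqP d0].
  have ab : b = a by lra.
  move=> U; rewrite FE /skew_hermitian jmapE c0 d0 ab.
  by apply: h5P; rewrite /Zc !mxE /=; ring.
pose r := Num.sqrt D.
have r0 : 0 < r by rewrite sqrtr_gt0.
have r2 : r ^+ 2 = D by rewrite sqr_sqrtr // ltW.
have cd : c ^+ 2 + d ^+ 2 = r ^+ 2 - ((a - b) / 2) ^+ 2 by rewrite r2 /D; ring.
have [||P1 P1E] := @unitary_eigenvector a b c d ((a + b) / 2 + r) FE.
- by rewrite cd; field.
- by apply/eqP; lra.
have [||P2 P2E] := @unitary_eigenvector a b c d ((a + b) / 2 - r) FE.
- by rewrite cd; field.
- by apply/eqP; lra.
exists ((a + b) / 2 + r), ((a + b) / 2 - r), P1, P2; split=> //.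
by apply/eqP; lra.
Qed.

(** - J F is symmetric with eigenvalues t1 and t2. *)
Lemma eigenvectors_orthogonal (t1 t2 : R) (P1 P2 : 'rV[R]_5) :
  t1 != t2 -> P1 0 4 = 0 -> P2 0 4 = 0 ->
  F P1 = t1 *: J P1 -> F P2 = t2 *: J P2 -> inner P1 P2 = 0.
Proof.
move=> t12 P14 P24 E1 E2.
have J2 : inner (J P1) (J P2) = inner P1 P2.
  by rewrite jmap_skew jmapK // innerNr opprK.
have FJ12 : inner (F P1) (J P2) = t1 * inner P1 P2 by rewrite E1 innerZl J2.
have : inner (F P1) (J P2) = t2 * inner P1 P2.
  rewrite Fskew FJ // E2 jmapZ jmapK // innerZr innerNr.
  by ring.
rewrite FJ12 => /eqP; rewrite -subr_eq0 -mulrBl mulf_eq0 subr_eq0 (negPf t12).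
by move/eqP.
Qed.

(** * Periodic trajectories of every energy *)

(** P is the initial horizontal velocity, and Q is defined by (z J + F) P = J Q.
    The equations for a, b and l say that (z J + F) J Q = - l^2 P, so that
    B = P / l and A = - J Q / l^2 satisfy the conditions on an ellipse. *)
Lemma periodic_trajectory (E : R) : ~ exact_force F -> 0 <= E ->
  exists sigma : R -> 'rV[R]_5,
    [/\ magnetic_trajectory F sigma, periodic_curve sigma &
        curve_energy sigma = E].
Proof.
move=> Fex E0.
have [t1 [t2 [P1 [P2 [t12 [n1 P14 E1] [n2 P24 E2]]]]]] := unitary_spectrum Fex.
have o12 := eigenvectors_orthogonal t12 P14 P24 E1 E2.
have [z [l [a [b [l0 a0 b0 [abE zE aE bE]]]]]] := energy_level t12 E0.
pose P := Num.sqrt a *: P1 + Num.sqrt b *: P2.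
pose Q := ((z + t1) * Num.sqrt a) *: P1 + ((z + t2) * Num.sqrt b) *: P2.
have P4 : P 0 4 = 0 by rewrite !mxE P14 P24 !mulr0 addr0.
have Q4 : Q 0 4 = 0 by rewrite !mxE P14 P24 !mulr0 addr0.
have PP x1 x2 y1 y2 :
    inner (x1 *: P1 + x2 *: P2) (y1 *: P1 + y2 *: P2) = x1 * y1 + x2 * y2.
  rewrite innerDl !innerZl ![inner _ (_ + _)]innerC !innerDl !innerZl n1 n2.
  by rewrite [inner P2 P1]innerC o12; ring.
have GZ (x : R) V : z *: J (x *: V) + F (x *: V) = x *: (z *: J V + F V).
  by rewrite jmapZ [F _]linearZ /= scalerDr !scalerA [z * x]mulrC.
have GP : z *: J P + F P = J Q.
  rewrite /P /Q linearD !linearZ /= E1 E2 !jmapD !jmapZ.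
  by apply/rowP => i; rewrite !mxE; ring.
(* The frequency condition on an eigenline matters only if its amplitude is
   nonzero. *)
have sqrtM (x y w : R) : x * y ^+ 2 = x * w ->
    y ^+ 2 * Num.sqrt x = w * Num.sqrt x.
  have [-> _|xn0] := eqVneq x 0; first by rewrite sqrtr0 !mulr0.
  by move/(mulfI xn0) => ->.
pose Q' := (t1 * ((z + t1) * Num.sqrt a)) *: P1
           + (t2 * ((z + t2) * Num.sqrt b)) *: P2.
have Q'4 : Q' 0 4 = 0 by rewrite !mxE P14 P24 !mulr0 addr0.
have FQ : F Q = J Q'.
  rewrite /Q /Q' linearD !linearZ /= E1 E2 jmapD !jmapZ !scalerA.
  by congr (_ *: _ + _ *: _); rewrite mulrC.
have GQ : z *: Q + Q' = l ^+ 2 *: P.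
  transitivity (((z + t1) ^+ 2 * Num.sqrt a) *: P1
                + ((z + t2) ^+ 2 * Num.sqrt b) *: P2).
    by rewrite /Q /Q'; apply/rowP => i; rewrite !mxE; ring.
  by rewrite (sqrtM _ _ _ aE) (sqrtM _ _ _ bE) /P scalerDr !scalerA.
have GJQ : z *: J (J Q) + F (J Q) = - l ^+ 2 *: P.
  by rewrite FJ // FQ !jmapK // scaleNr -GQ scalerN [RHS]opprD.
pose A := - (l ^+ 2)^-1 *: J Q; pose B := l^-1 *: P.
have A4 : A 0 4 = 0 by rewrite mxE jmap4 mulr0.
have B4 : B 0 4 = 0 by rewrite mxE P4 mulr0.
have zAB : z = - 2^-1 * l * symp A B.
  rewrite symp_jmap /A /B jmapZ jmapK // scalerN -scaleNr innerZl innerZr PP.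
  have -> : (z + t1) * Num.sqrt a * Num.sqrt a + (z + t2) * Num.sqrt b * Num.sqrt b
            = (z + t1) * a + (z + t2) * b.
    by rewrite -!mulrA -!expr2 !sqr_sqrtr.
  have -> : (z + t1) * a + (z + t2) * b = - (2 * z * l ^+ 2) by lra.
  by field.
exists (osc l A B); split; last 2 first.
- exact: periodic_osc.
- rewrite (osc_energy A4 B4 zAB) /B innerZl innerZr PP -!expr2.
  rewrite !sqr_sqrtr // (_ : a + b = 2 * E - z ^+ 2); last by lra.
  by field.
apply: (osc_magnetic FZ0 A4 B4 zAB).
- rewrite /A GZ GJQ scalerA.
  by rewrite /B scalerA; congr (_ *: _); field.
- rewrite /B GZ GP.
  by rewrite /A scalerA; congr (_ *: _); field.
Qed.

End UnitaryForce.

Theorem proposition4p7 (R : realType) (F : 'End('rV[R]_5)) :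
  lorentz_force F ->
  type_I F ->
  (forall Zt V : 'rV[R]_5, Zt \in vspace_z R -> V \in vspace_v R ->
     F (jmap Zt V) = jmap Zt (F V)) ->
  ~ exact_force F ->
  forall E : R, 0 <= E ->
    exists sigma : R -> 'rV[R]_5,
      [/\ magnetic_trajectory F sigma,
          periodic_curve sigma &
          curve_energy sigma = E].
Proof.
move=> [Fskew _] [_ Fz] FJ Fex E E0.
(* F Z is a multiple of Z, and it is orthogonal to Z because F is skew. *)
have FZ0 : F (Zc R) = 0.
  have /vlineP[k Fk] : F (Zc R) \in vspace_z R.
    by apply: (subvP Fz); apply: memv_img; exact: memv_line.
  have := Fskew (Zc R) (Zc R); rewrite Fk innerZl innerZr.
  rewrite innerE /Zc !mxE /= => k0.
  by rewrite (_ : k = 0) ?scale0r //; lra.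
apply: periodic_trajectory => // V V4; apply: FJ; first exact: memv_line.
have -> : V = V 0 0 *: X1 R + V 0 1 *: Y1 R + V 0 2 *: X2 R + V 0 3 *: Y2 R.
  by apply: h5P; rewrite !mxE /= ?V4; ring.
by rewrite !memvD // memvZ // memv_span // !inE eqxx ?orbT.
Qed.
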